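(* Let $f:G\to H$ be a morphism in the category of hyperbolic hypergroups. Then $f$ is a monomorphism (in the category of hyperbolic hypergroups) if and only if $f$ is injective.
   Context: A hypergroup is a quadruple $(G,\ast,r,1)$ where $G$ is a non-empty set, $\ast:G\times G\to\mathcal P(G)\setminus\{\emptyset\}$ (with $\mathcal P(G)$ the power set) and $r:G\to G$ are functions, and $1\in G$, such that for all $x,y,z\in G$: (i) if $z\in x\ast y$ then $x\in z\ast r(y)$ and $y\in r(x)\ast z$; (ii) $y\in 1\ast x$ if and only if $x=y$; (iii) $x\ast(y\ast z)=(x\ast y)\ast z$, where $x\ast(y\ast z)=\bigcup_{w\in y\ast z}x\ast w$ and $(x\ast y)\ast z=\bigcup_{t\in x\ast y}t\ast z$. Write $a^{-1}:=r(a)$. A morphism of hypergroups $f:G\to H$ is a map such that for all $a,b,c\in G$: $c\in a\ast b$ implies $f(c)\in f(a)\ast f(b)$; $f(a^{-1})=f(a)^{-1}$; $f(1)=1$. A hypergroup $G$ is hyperbolic if $a\ast a^{-1}=G$ for all $a\in G\setminus\{1\}$. The category of hyperbolic hypergroups has hyperbolic hypergroups as objects and all morphisms of hypergroups between them as morphisms. *)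

(* Defs.v *)
From mathcomp Require Import all_boot.
From mathcomp Require Import boolp classical_sets.

Set Implicit Arguments.
Unset Strict Implicit.
Unset Printing Implicit Defensive.

Local Open Scope classical_set_scope.

(* The hyperoperation takes values in [set G], so [hmul x y z] reads
   "z belongs to x * y". *)
Record hypergroup := Hypergroup {
  hcarrier :> Type;
  hmul : hcarrier -> hcarrier -> set hcarrier;
  hinv : hcarrier -> hcarrier;
  hone : hcarrier;
  hmul_neq0 : forall x y, hmul x y !=set0;
  hmul_rev : forall x y z, hmul x y z -> hmul z (hinv y) x /\ hmul (hinv x) z y;
  hmul1 : forall x y, hmul hone x y <-> x = y;
  hmulA : forall x y z,
    \bigcup_(w in hmul y z) hmul x w = \bigcup_(t in hmul x y) hmul t z
}.
Arguments hone {h}.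

Record hyperhom (G H : hypergroup) := Hyperhom {
  hyperhom_fun :> G -> H;
  hyperhom_mul : forall a b c,
    hmul a b c -> hmul (hyperhom_fun a) (hyperhom_fun b) (hyperhom_fun c);
  hyperhom_inv : forall a, hyperhom_fun (hinv a) = hinv (hyperhom_fun a);
  hyperhom_one : hyperhom_fun hone = hone
}.

Definition hyperhom_comp (G H K : hypergroup)
    (f : hyperhom H K) (g : hyperhom G H) : hyperhom G K.
Proof.
exists (f \o g) => [a b c abc|a|] /=.
- by do 2!apply: hyperhom_mul.
- by rewrite !hyperhom_inv.
- by rewrite !hyperhom_one.
Defined.

Lemma hyperhom_eq (G H : hypergroup) (f g : hyperhom G H) :
  (f : G -> H) = g -> f = g.
Proof.
case: f g => [f fM fV f1] [g gM gV g1] /= fg; rewrite -{}fg in gM gV g1 *.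
by congr Hyperhom; exact: Prop_irrelevance.
Qed.

Definition hyperbolic (G : hypergroup) :=
  forall a : G, a <> hone -> hmul a (hinv a) = [set: G].

(* Objects of the category of hyperbolic hypergroups, a full subcategory: its
   morphisms are all the [hyperhom]s between the underlying hypergroups. *)
Record hyperbolicHypergroup := HyperbolicHypergroup {
  hypergroup_of :> hypergroup;
  hyperbolicP : hyperbolic hypergroup_of
}.

Definition hyperbolic_mono (G H : hyperbolicHypergroup) (f : hyperhom G H) :=
  forall (K : hyperbolicHypergroup) (g h : hyperhom K G),
    hyperhom_comp f g = hyperhom_comp f h -> g = h.

(* Main.v *)
Require Import Defs.
From mathcomp Require Import all_boot.
From mathcomp Require Import boolp classical_sets.

(** The idea is that the underlying-set functor on hyperbolic hypergroups is
    representable, and a representable functor preserves monomorphisms.  The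
    representing object is the hypergroup of signs {0, +, -}, in which
    + * + = {+}, - * - = {-} and + * - = - * + = {0, +, -} (the additive
    hypergroup of the hyperfield of signs).  Every point [a] of a hyperbolic
    hypergroup satisfies [a \in a * a]: this follows by reversibility from
    [a \in a * a^-1], which is clear for [a = 1] and otherwise holds because
    [a * a^-1] is everything.  Likewise [a^-1] and 1 lie in [a * a^-1], so the
    assignment sending + to [a], - to [a^-1] and 0 to 1 is a morphism.  If
    [f a = f b], the morphisms classifying [a] and [b] become equal after
    composition with [f]; a monomorphism [f] then forces them to agree, and
    evaluating at + gives [a = b].  The converse is the usual fact that an
    injective map is left cancellable. *)

Set Implicit Arguments.
Unset Strict Implicit.
Unset Printing Implicit Defensive.

Local Open Scope classical_set_scope.

(** * Inverses and the unit in a hypergroup *)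

Section HypergroupTheory.
Variable G : hypergroup.
Implicit Types x : G.

Lemma hmul1x x : hmul hone x x.
Proof. exact/hmul1. Qed.

Lemma hmulxV x : hmul x (hinv x) hone.
Proof. exact: (hmul_rev (hmul1x x)).1. Qed.

Lemma hinvK x : hinv (hinv x) = x.
Proof. exact/hmul1/(hmul_rev (hmulxV x)).1. Qed.

Lemma hinv1 : hinv (hone : G) = hone.
Proof. exact/hmul1/hmulxV. Qed.

(** The axioms only give the unit law on the left; reversing
    [1 \in x^-1 * x] carries it over to the right. *)
Lemma hmulx1 x : hmul x hone x.
Proof. by have := (hmul_rev (hmulxV (hinv x))).2; rewrite hinvK. Qed.

End HypergroupTheory.

(** * Points of a hyperbolic hypergroup *)

Section HyperbolicTheory.
Variable G : hyperbolicHypergroup.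
Implicit Types a : G.

Lemma mem_hmulxV a : hmul a (hinv a) a.
Proof.
have [->|a1] := pselect (a = hone); first by rewrite hinv1; exact: hmul1x.
by rewrite (hyperbolicP a1).
Qed.

Lemma memV_hmulxV a : hmul a (hinv a) (hinv a).
Proof.
have [->|a1] := pselect (a = hone); first by rewrite hinv1; exact: hmul1x.
by rewrite (hyperbolicP a1).
Qed.

Lemma mem_hmulxx a : hmul a a a.
Proof. by have := (hmul_rev (mem_hmulxV a)).1; rewrite hinvK. Qed.

End HyperbolicTheory.

(** * The hypergroup of signs *)

(** [None] is the sign 0, [Some true] is + and [Some false] is -. *)
Definition sign_mul (x y : option bool) : set (option bool) :=
  match x, y with
  | None, _ => [set y]
  | _, None => [set x]
  | Some b, Some c => if b == c then [set x] else setT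
  end.

Definition sign_inv : option bool -> option bool := omap negb.

Lemma sign_mul_neq0 x y : sign_mul x y !=set0.
Proof.
case: x => [b|]; last by exists y.
by exists (Some b); case: y => [c|] //=; case: ifP.
Qed.

Lemma sign_mul_rev x y z :
  sign_mul x y z -> sign_mul z (sign_inv y) x /\ sign_mul (sign_inv x) z y.
Proof. by case: x y z => [[]|] [[]|] [[]|]. Qed.

Lemma sign_mul1 x y : sign_mul None x y <-> x = y.
Proof. by split=> ->. Qed.

Lemma sign_mulA x y z :
  \bigcup_(w in sign_mul y z) sign_mul x w =
  \bigcup_(t in sign_mul x y) sign_mul t z.
Proof.
apply/seteqP; split=> u [w]; case: x y z u w => [[]|] [[]|] [[]|] [[]|] [[]|] //=;
  move=> _ _; by [exists None | exists (Some true) | exists (Some false)].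
Qed.

Definition sign_hypergroup : hypergroup :=
  Hypergroup sign_mul_neq0 sign_mul_rev sign_mul1 sign_mulA.

Lemma sign_hyperbolic : hyperbolic sign_hypergroup.
Proof. by move=> [[]|]. Qed.

Definition sign_hyperbolicHypergroup : hyperbolicHypergroup :=
  HyperbolicHypergroup sign_hyperbolic.

(** * The morphism classifying a point *)

Section SignHom.
Variables (G : hyperbolicHypergroup) (a : G).

Definition sign_hom_fun (x : sign_hyperbolicHypergroup) : G :=
  match x with
  | None => hone
  | Some b => if b then a else hinv a
  end.

Lemma sign_hom_mul x y z :
  hmul x y z -> hmul (sign_hom_fun x) (sign_hom_fun y) (sign_hom_fun z).
Proof.
(* The products of - with + are those of + with - for the point [a^-1]. *)
have VxM : [/\ hmul (hinv a) a hone, hmul (hinv a) a a &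
               hmul (hinv a) a (hinv a)].
  by have := And3 (hmulxV (hinv a)) (memV_hmulxV (hinv a)) (mem_hmulxV (hinv a));
    rewrite hinvK.
case: VxM => Va1 Vaa VaV.
by case: x y z => [[]|] [[]|] [[]|] //= _;
  do ?[exact: mem_hmulxx | exact: hmulxV | exact: mem_hmulxV
      | exact: memV_hmulxV | exact: hmul1x | exact: hmulx1].
Qed.

Lemma sign_hom_inv x : sign_hom_fun (hinv x) = hinv (sign_hom_fun x).
Proof. by case: x => [[]|] /=; rewrite ?hinvK ?hinv1. Qed.

Definition sign_hom : hyperhom sign_hyperbolicHypergroup G :=
  Hyperhom sign_hom_mul sign_hom_inv erefl.

End SignHom.

(** Naturality of the classifying morphism in the hypergroup: this is what lets
    [f a = f b] be read as an equality of composites with [f]. *)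
Lemma sign_hom_comp (G H : hyperbolicHypergroup) (f : hyperhom G H) (a : G) :
  hyperhom_comp f (sign_hom a) = sign_hom (f a).
Proof.
apply: hyperhom_eq; apply/funext => -[[]|] //=.
- exact: hyperhom_inv.
- exact: hyperhom_one.
Qed.

(** * Monomorphisms *)

Theorem theorem4p4 (G H : hyperbolicHypergroup) (f : hyperhom G H) :
  hyperbolic_mono f <-> injective f.
Proof.
split=> [f_mono a b fab|f_inj K g h fgh].
- have /f_mono gab : hyperhom_comp f (sign_hom a) = hyperhom_comp f (sign_hom b).
    by rewrite !sign_hom_comp fab.
  exact: (congr1 (fun g : hyperhom sign_hyperbolicHypergroup G => g (Some true)) gab).
- apply: hyperhom_eq; apply/funext => x; apply: f_inj.
  exact: (congr1 (fun g : hyperhom K H => g x) fgh).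
Qed.
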